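(* Let $k \geq 2$ be an integer. Let $(n_i)_{i=1}^\infty$ and $(n_i')_{i=1}^\infty$ be strictly increasing sequences in $\mathbb{N}$ with $n_i \mid n_{i+1}$ and $n_i' \mid n_{i+1}'$ for all $i \in \mathbb{N}$. Suppose there is a prime power dividing some $n_{i_0}$ that is not a factor of any number in the sequence $(n_i')_{i=1}^\infty$. Then $$\varinjlim \frac{\mathbb{Z}}{(k^{n_i} - 1)\mathbb{Z}} \not\cong \varinjlim \frac{\mathbb{Z}}{(k^{n_i'} - 1)\mathbb{Z}}$$ as abelian groups, where the connecting maps are the group homomorphisms $\mathbb{Z}/(k^{n_i}-1)\mathbb{Z} \to \mathbb{Z}/(k^{n_{i+1}}-1)\mathbb{Z}$, $x \mapsto \frac{k^{n_{i+1}}-1}{k^{n_i}-1}x$, and $\mathbb{Z}/(k^{n_i'}-1)\mathbb{Z} \to \mathbb{Z}/(k^{n_{i+1}'}-1)\mathbb{Z}$, $x \mapsto \frac{k^{n_{i+1}'}-1}{k^{n_i'}-1}x$, respectively.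
   Context: $\mathbb{N}=\{1,2,3,\ldots\}$. *)

(* Defs.v *)
From HB Require Import structures.
From mathcomp Require Import all_boot all_order all_algebra.
From mathcomp Require Import boolp.

Set Implicit Arguments.
Unset Strict Implicit.
Unset Printing Implicit Defensive.

Import GRing.Theory.
Local Open Scope ring_scope.
Local Open Scope quotient_scope.

(* The direct limit of  G 0 --f 0--> G 1 --f 1--> G 2 --> ...  is the disjoint
   union {i & G i} modulo "eventually equal".  An element u of the disjoint
   union sits at level [tag u]; [dl_step] pushes it one level up, so equality
   in {i & G i} of two pushed elements says that they have reached a common
   level and coincide there. *)
Section DirectLimit.
Variables (G : nat -> zmodType) (f : forall i, {additive G i -> G i.+1}).
Notation elt := {i : nat & G i}.
Implicit Types (u v w : elt) (i m n : nat).

Definition dl_step u : elt := Tagged G (f (tag u) (tagged u)).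

Definition dl_eventually_eq u v : bool :=
  `[< exists m n, iter m dl_step u = iter n dl_step v >].

Lemma dl_evP u v : reflect (exists m n, iter m dl_step u = iter n dl_step v)
                           (dl_eventually_eq u v).
Proof. exact: asboolP. Qed.

Lemma dl_ev_refl : reflexive dl_eventually_eq.
Proof. by move=> u; apply/dl_evP; exists 0%N, 0%N. Qed.

Lemma dl_ev_sym : symmetric dl_eventually_eq.
Proof.
by move=> u v; apply/dl_evP/dl_evP => -[m [n e]]; exists n, m.
Qed.

Lemma dl_ev_trans : transitive dl_eventually_eq.
Proof.
move=> v u w /dl_evP[m [n e]] /dl_evP[p [q e']].
apply/dl_evP; exists (p + m)%N, (n + q)%N.
by rewrite iterD e -iterD addnC iterD e' -iterD.
Qed.

Canonical dl_equiv := EquivRel dl_eventually_eq dl_ev_refl dl_ev_sym dl_ev_trans.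

Definition dirlim := {eq_quot dl_equiv}.

HB.instance Definition _ := Choice.on dirlim.
HB.instance Definition _ := EqQuotient.on dirlim.

Definition dl_zero : elt := Tagged G (0 : G 0%N).
Definition dl_opp u : elt := Tagged G (- tagged u).

(* Meaningful only when u and v have the same tag. *)
Definition dl_add_level u v : elt :=
  Tagged G (tagged u + tagged_as u v).

Definition dl_add u v : elt :=
  dl_add_level (iter (tag v) dl_step u) (iter (tag u) dl_step v).

Lemma tag_iter_step n u : tag (iter n dl_step u) = (n + tag u)%N.
Proof. by elim: n => //= n ->. Qed.

Lemma dl_add_levelE i (x y : G i) :
  dl_add_level (Tagged G x) (Tagged G y) = Tagged G (x + y).
Proof. by rewrite /dl_add_level tagged_asE. Qed.

Lemma iter_step_add n u v : tag u = tag v ->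
  iter n dl_step (dl_add_level u v) =
  dl_add_level (iter n dl_step u) (iter n dl_step v).
Proof.
move=> e; elim: n => //= n ->.
have : tag (iter n dl_step u) = tag (iter n dl_step v).
  by rewrite !tag_iter_step e.
case: (iter n _ u) (iter n _ v) => [i x] [j y] /= eij.
by case: _ / eij y => y; rewrite !dl_add_levelE /dl_step /= raddfD
  -dl_add_levelE.
Qed.

Lemma iter_step_opp n u :
  iter n dl_step (dl_opp u) = dl_opp (iter n dl_step u).
Proof.
elim: n => //= n ->.
by case: (iter n _ u) => i x; rewrite /dl_step /dl_opp /= raddfN.
Qed.

Lemma dl_ev_step n u : dl_eventually_eq (iter n dl_step u) u.
Proof. by apply/dl_evP; exists 0%N, n. Qed.

Lemma dl_ev_add_level u v u' v' : tag u = tag v -> tag u' = tag v' ->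
  dl_eventually_eq u u' -> dl_eventually_eq v v' ->
  dl_eventually_eq (dl_add_level u v) (dl_add_level u' v').
Proof.
move=> e e' /dl_evP[m [m' h]] /dl_evP[p [p' k]].
have hm := congr1 tag h; have kp := congr1 tag k.
rewrite !tag_iter_step in hm kp.
have E : (p + m')%N = (m + p')%N.
  apply/eqP; rewrite -(eqn_add2r (tag u')) -addnA -hm.
  by rewrite e' -addnA -kp -e addnCA.
apply/dl_evP; exists (p + m)%N, (p + m')%N.
rewrite !iter_step_add //; congr dl_add_level.
  by rewrite !iterD h.
by rewrite E addnC !iterD k.
Qed.

Lemma tag_dl_add u v :
  tag (iter (tag v) dl_step u) = tag (iter (tag u) dl_step v).
Proof. by rewrite !tag_iter_step addnC. Qed.

Lemma dl_ev_add_at i (x y : G i) u v :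
  dl_eventually_eq u (Tagged G x) -> dl_eventually_eq v (Tagged G y) ->
  dl_eventually_eq (dl_add u v) (Tagged G (x + y)).
Proof.
move=> ux vy; rewrite -dl_add_levelE; apply: dl_ev_add_level => //.
- exact: tag_dl_add.
- by apply: dl_ev_trans ux; apply: dl_ev_step.
- by apply: dl_ev_trans vy; apply: dl_ev_step.
Qed.

Definition dl_in i (x : G i) : dirlim := \pi_dirlim (Tagged G x).

Lemma dl_inP i (x : G i) j (y : G j) :
  dl_in x = dl_in y <-> dl_eventually_eq (Tagged G x) (Tagged G y).
Proof. by split=> [/eqmodP|h]; last by apply/eqmodP. Qed.

Lemma dl_repr i (x : G i) :
  dl_eventually_eq (repr (dl_in x)) (Tagged G x).
Proof. by apply/eqmodP; rewrite reprK. Qed.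

Lemma dl_in_step i (x : G i) : dl_in (f i x) = dl_in x.
Proof. by apply/dl_inP; apply: (dl_ev_step 1 (Tagged G x)). Qed.

Definition dirlim_zero : dirlim := \pi_dirlim dl_zero.
Definition dirlim_opp (a : dirlim) : dirlim := \pi_dirlim (dl_opp (repr a)).
Definition dirlim_add (a b : dirlim) : dirlim :=
  \pi_dirlim (dl_add (repr a) (repr b)).

Lemma dirlim_addE i (x y : G i) :
  dirlim_add (dl_in x) (dl_in y) = dl_in (x + y).
Proof. by apply/eqmodP; apply: dl_ev_add_at; apply: dl_repr. Qed.

Lemma dirlim_oppE i (x : G i) : dirlim_opp (dl_in x) = dl_in (- x).
Proof.
apply/eqmodP; have /dl_evP[m [n e]] := dl_repr x.
apply/dl_evP; exists m, n.
by rewrite -[Tagged G (- x)]/(dl_opp (Tagged G x)) !iter_step_opp e.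
Qed.

Lemma dirlim_zeroE i : dirlim_zero = dl_in (0 : G i).
Proof.
elim: i => // i ->; rewrite -dl_in_step; congr dl_in; exact: raddf0.
Qed.

Lemma dl_in_iter n i (x : G i) : exists y : G (n + i)%N, dl_in x = dl_in y.
Proof.
elim: n => [|n [y ->]]; first by exists x.
by exists (f _ y); rewrite dl_in_step.
Qed.

Lemma dirlim_elim (a : dirlim) : exists i (x : G i), a = dl_in x.
Proof.
by exists (tag (repr a)), (tagged (repr a)); rewrite /dl_in taggedK reprK.
Qed.

Lemma dirlim_elim2 (a b : dirlim) :
  exists i (x y : G i), a = dl_in x /\ b = dl_in y.
Proof.
have [i [x ->]] := dirlim_elim a; have [j [y ->]] := dirlim_elim b.
have [x' ->] := dl_in_iter j x; have [y' ->] := dl_in_iter i y.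
by move: y'; rewrite addnC => y'; exists (j + i)%N, x', y'.
Qed.

Lemma dirlim_elim3 (a b c : dirlim) :
  exists i (x y z : G i), [/\ a = dl_in x, b = dl_in y & c = dl_in z].
Proof.
have [i [x [y [-> ->]]]] := dirlim_elim2 a b.
have [j [z ->]] := dirlim_elim c.
have [x' ->] := dl_in_iter j x; have [y' ->] := dl_in_iter j y.
have [z' ->] := dl_in_iter i z.
by move: z'; rewrite addnC => z'; exists (j + i)%N, x', y', z'.
Qed.

Lemma dirlim_addA : associative dirlim_add.
Proof.
move=> a b c; have [i [x [y [z [-> -> ->]]]]] := dirlim_elim3 a b c.
by rewrite !dirlim_addE addrA.
Qed.

Lemma dirlim_addC : commutative dirlim_add.
Proof.
move=> a b; have [i [x [y [-> ->]]]] := dirlim_elim2 a b.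
by rewrite !dirlim_addE addrC.
Qed.

Lemma dirlim_add0 : left_id dirlim_zero dirlim_add.
Proof.
move=> a; have [i [x ->]] := dirlim_elim a.
by rewrite (dirlim_zeroE i) dirlim_addE add0r.
Qed.

Lemma dirlim_addN : left_inverse dirlim_zero dirlim_opp dirlim_add.
Proof.
move=> a; have [i [x ->]] := dirlim_elim a.
by rewrite dirlim_oppE dirlim_addE addNr -dirlim_zeroE.
Qed.

HB.instance Definition _ := GRing.isZmodule.Build dirlim
  dirlim_addA dirlim_addC dirlim_add0 dirlim_addN.

Lemma dl_in_is_additive i : zmod_morphism (@dl_in i).
Proof.
by move=> x y; rewrite -[RHS]/(dirlim_add _ (dirlim_opp _))
  dirlim_oppE dirlim_addE.
Qed.

HB.instance Definition _ i :=
  GRing.isZmodMorphism.Build (G i) dirlim (@dl_in i) (@dl_in_is_additive i).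

Lemma dirlim_universal (H : zmodType) (g : forall i, {additive G i -> H}) :
  (forall i (x : G i), g i.+1 (f i x) = g i x) ->
  exists h : {additive dirlim -> H},
    (forall i (x : G i), h (dl_in x) = g i x) /\
    (forall h' : {additive dirlim -> H},
       (forall i (x : G i), h' (dl_in x) = g i x) -> h' =1 h).
Proof.
move=> gf.
pose h (a : dirlim) : H := g (tag (repr a)) (tagged (repr a)).
have giter n u : g (tag (iter n dl_step u)) (tagged (iter n dl_step u))
                 = g (tag u) (tagged u).
  by elim: n => //= n <-; rewrite gf.
have hE i (x : G i) : h (dl_in x) = g i x.
  have /dl_evP[m [n e]] := dl_repr x.
  by rewrite /h -(giter m) e giter.
have hD : zmod_morphism h.
  move=> a b; have [i [x [y [-> ->]]]] := dirlim_elim2 a b.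
  by rewrite -raddfB !hE raddfB.
pose hm := GRing.isZmodMorphism.Build _ _ h hD.
pose H' : {additive dirlim -> H} := HB.pack h hm.
exists H'; split=> // h' h'E a.
by have [i [x ->]] := dirlim_elim a; rewrite h'E -hE.
Qed.

End DirectLimit.

(* Z/mZ for m > 0: the carrier is 'I_m.  The library's 'Z_m is not used because
   'Z_1 is Z/2Z, whereas the trivial group Z/1Z does occur (m = 2 ^ 1 - 1). *)
Definition Zmod (m : nat) : zmodType := 'I_m.-1.+1.

(* The map Z/mZ -> Z/m'Z, x |-> (m' / m) x, for m dividing m'. *)
Definition Zmod_mul (m m' : nat) (x : Zmod m) : Zmod m' :=
  inZp (m' %/ m * x).

Lemma Zmod_mul_is_additive (m m' : nat) :
  (m %| m')%N -> nmod_morphism (@Zmod_mul m m').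
Proof.
move=> /dvdnP[q ->]; split=> [|x y].
  by apply: val_inj; rewrite /= muln0 mod0n.
case: m x y => [|m] x y; first by apply: val_inj; rewrite /= muln0 !modn1.
case: q => [|q]; first by apply: val_inj; rewrite /= !modn1.
apply: val_inj => /=; rewrite mulnK // -[((q.+1 * m.+1)%N).-1.+1]/(q.+1 * m.+1)%N.
by rewrite modnDm -mulnDr -!muln_modr modn_mod.
Qed.

Definition Zmod_mul_additive (m m' : nat) (h : (m %| m')%N) :
  {additive Zmod m -> Zmod m'} :=
  HB.pack (@Zmod_mul m m')
    (GRing.isNmodMorphism.Build _ _ (@Zmod_mul m m') (Zmod_mul_is_additive h)).

Lemma dvdn_expn_sub1 (k a b : nat) :
  (a %| b)%N -> (k ^ a - 1 %| k ^ b - 1)%N.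
Proof.
by move=> /dvdnP[q ->]; rewrite mulnC expnM !subn1 dvdn_pred_predX.
Qed.

(* The direct limit of the groups Z/(k ^ n i - 1)Z along the maps
   x |-> ((k ^ n i.+1 - 1) / (k ^ n i - 1)) x. *)
Definition lim_Zmod_exp_sub1 (k : nat) (n : nat -> nat)
    (ndvd : forall i, (n i %| n i.+1)%N) : zmodType :=
  dirlim (G := fun i => Zmod (k ^ n i - 1))
    (fun i => Zmod_mul_additive (dvdn_expn_sub1 k (ndvd i))).

Arguments lim_Zmod_exp_sub1 k n ndvd : clear implicits.

(* Main.v *)
Require Import Defs.
From mathcomp Require Import all_boot all_order all_algebra.

Import GRing.Theory.

(** The limit attached to [n] is a group in which every element has finite
    order, and the orders that occur are exactly the divisors of the numbers
    [k ^ n i - 1]: the connecting maps are injective, so that each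
    [Z/(k ^ n i - 1)] embeds in the limit with its orders unchanged
    ([lim_generator_order_dvd]), and conversely each element of the limit comes
    from some [Z/(k ^ n i - 1)] ([lim_torsion]).  Orders are preserved by
    injective homomorphisms.  An isomorphism would therefore send the element of
    order [k ^ n i0 - 1] to an element killed by some [k ^ n' j - 1], whence
    [k ^ n i0 - 1] divides [k ^ n' j - 1].  For [k >= 2] this forces [n i0] to
    divide [n' j] ([dvdn_expn_sub1_inv]), and then every prime power dividing
    [n i0] divides [n' j] too. *)

(** The remainder [r] of [b] modulo [a] satisfies
    [k ^ b - 1 = k ^ r * (k ^ (b - r) - 1) + (k ^ r - 1)], where [k ^ a - 1]
    divides the first summand; so it divides [k ^ r - 1], which is too small
    to be a multiple of it unless [r = 0]. *)
Lemma dvdn_expn_sub1_inv (k a b : nat) : 1 < k -> 0 < a ->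
  k ^ a - 1 %| k ^ b - 1 -> a %| b.
Proof.
move=> k1 a0; have k0 : 0 < k := ltnW k1.
set q := b %/ a * a; set r := b %% a.
have -> : k ^ b - 1 = k ^ r * (k ^ q - 1) + (k ^ r - 1).
  rewrite mulnBr muln1 -expnD addnBA ?expn_gt0 ?k0 // subnK.
    by rewrite addnC -divn_eq.
  by rewrite leq_pexp2l ?leq_addr.
rewrite dvdn_addr; last by apply/dvdn_mull/dvdn_expn_sub1/dvdn_mull.
have ra : k ^ r - 1 < k ^ a - 1.
  by rewrite ltn_sub2rE ?expn_gt0 ?k0 // ltn_exp2l // ltn_mod.
have [r0 _|r0 dvd_r] := posnP r; first by rewrite /dvdn -/r r0.
have kr : 0 < k ^ r - 1 by rewrite subn_gt0 -{1}(expn0 k) ltn_exp2l.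
by have := dvdn_leq kr dvd_r; rewrite leqNgt ra.
Qed.

Section DirectLimitInjective.
Variables (G : nat -> zmodType) (f : forall i, {additive G i -> G i.+1}).
Hypothesis f_inj : forall i, injective (f i).

Lemma dl_step_inj : injective (dl_step f).
Proof.
move=> [i x] [j y] h; have [eij] := congr1 tag h.
case: _ / eij y h => y /eqP; rewrite /dl_step /= eq_Tagged /= => /eqP h.
by rewrite (f_inj _ _ _ h).
Qed.

(** Two elements of the same level that become equal do so after equally many
    steps, since a step raises the level by one. *)
Lemma dl_in_inj i : injective (@dl_in G f i).
Proof.
move=> x y /dl_inP/dl_evP[m [n h]]; have := congr1 tag h.
rewrite !tag_iter_step => /addIn mn; rewrite {}mn in h.
have /eqP : Tagged G x = Tagged G y by elim: n h => //= n IHn /dl_step_inj.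
by rewrite eq_Tagged /= => /eqP.
Qed.

End DirectLimitInjective.

Local Open Scope ring_scope.

Lemma Zmod_mulrn_eq0 (m : nat) (x : Zmod m) : (0 < m)%N -> x *+ m = 0.
Proof.
case: m x => // m x _; rewrite Zp_mulrn; apply: val_inj => /=.
by rewrite modnMl.
Qed.

Lemma order_Zmod_generator (m d : nat) : (0 < m)%N ->
  (inZp 1 : Zmod m) *+ d = 0 -> (m %| d)%N.
Proof.
case: m => // m _; rewrite Zp_mulrn => /(congr1 val) /= h.
by rewrite /dvdn -h modnMml mul1n.
Qed.

(** With [m' = q * m] the map is [x |-> q * x], where [q > 0] because [m' > 0];
    since representatives satisfy [x < m], the product [q * x < m'] is already
    reduced, and [q] can be cancelled in the natural numbers. *)
Lemma Zmod_mul_inj (m m' : nat) : (m %| m')%N -> (0 < m')%N ->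
  injective (@Zmod_mul m m').
Proof.
move=> /dvdnP[q ->]; rewrite muln_gt0 => /andP[q0 m0] x y /(congr1 val) /=.
have red (z : Zmod m) : (q * z < q * m)%N.
  by rewrite ltn_pmul2l //; case: (m) m0 z => // n _ z; apply: ltn_ord.
rewrite (@prednK (q * m)) ?muln_gt0 ?q0 // mulnK // !modn_small ?red //.
by move=> /eqP; rewrite eqn_pmul2l // => /eqP /val_inj.
Qed.

Section LimZmod.
Variables (k : nat) (n : nat -> nat).
Hypotheses (k_gt1 : (1 < k)%N) (n_gt0 : forall i, (0 < n i)%N).
Hypothesis n_dvd : forall i, (n i %| n i.+1)%N.

Let f i := Zmod_mul_additive (dvdn_expn_sub1 k (n_dvd i)).

Let modulus_gt0 i : (0 < k ^ n i - 1)%N.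
Proof. by rewrite subn_gt0 -{1}(expn0 k) ltn_exp2l. Qed.

Lemma lim_torsion (a : lim_Zmod_exp_sub1 k n n_dvd) :
  exists i, a *+ (k ^ n i - 1) = 0.
Proof.
have [i [x ->]] := dirlim_elim a.
by exists i; rewrite -raddfMn Zmod_mulrn_eq0 // raddf0.
Qed.

(** The class of [1] in [Z/(k ^ n i - 1)] does not collapse in the limit, so
    only multiples of the modulus kill it. *)
Lemma lim_generator_order_dvd i : exists a : lim_Zmod_exp_sub1 k n n_dvd,
  forall d, a *+ d = 0 -> (k ^ n i - 1 %| d)%N.
Proof.
have f_inj j : injective (f j) by apply: Zmod_mul_inj; first exact: dvdn_expn_sub1.
exists (@dl_in _ f i (inZp 1)) => d.
rewrite -raddfMn -(raddf0 (@dl_in _ f i)) => /(dl_in_inj _ _ f_inj _ _ _).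
exact: order_Zmod_generator.
Qed.

End LimZmod.

Local Close Scope ring_scope.

Theorem corollary3p8 (k : nat) (hk : (2 <= k)%N)
    (n n' : nat -> nat)
    (n_gt0 : forall i, (0 < n i)%N) (n'_gt0 : forall i, (0 < n' i)%N)
    (n_incr : forall i j, (i < j)%N -> (n i < n j)%N)
    (n'_incr : forall i j, (i < j)%N -> (n' i < n' j)%N)
    (n_dvd : forall i, (n i %| n i.+1)%N)
    (n'_dvd : forall i, (n' i %| n' i.+1)%N)
    (h_pp : exists p e i0 : nat,
       [/\ prime p, (0 < e)%N, (p ^ e %| n i0)%N
         & forall i, ~~ (p ^ e %| n' i)%N]) :
  ~ exists phi : {additive lim_Zmod_exp_sub1 k n n_dvd
                           -> lim_Zmod_exp_sub1 k n' n'_dvd},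
      bijective phi.
Proof.
move=> [phi /bij_inj phi_inj].
have [p [e [i0 [_ _ pe_n pe_n']]]] := h_pp.
have [a a_order] := lim_generator_order_dvd _ _ hk n_gt0 n_dvd i0.
have [j phi_a] := lim_torsion _ _ hk n'_gt0 n'_dvd (phi a).
apply: (negP (pe_n' j)); apply: (dvdn_trans pe_n).
apply: (dvdn_expn_sub1_inv _ _ _ hk (n_gt0 i0)); apply: a_order.
by apply: phi_inj; rewrite raddfMn phi_a raddf0.
Qed.
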